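(* Let $\mathcal{X}\subseteq\mathbb{R}^n$ be nonempty, closed and convex, let $a_0\in\mathbb{R}^n$, let $\mathcal{V}\subset\mathbb{R}^n$ be compact, smooth and strictly convex with $0\in\mathrm{int}(\mathcal{V})$, and let $\varphi(\cdot)=g(\|\cdot\|_{\mathcal{V}^{\circ}})$, where $g:\mathbb{R}\to[0,\infty)$ is Legendre with $g(0)=0$ and $g'(0)=0$. Assume the Bregman projection induced by $\varphi$ is $\kappa$-expansive. Let $x_{\mathrm{R}}'(\omega)$ be the robust path and let $x_{\mathrm{CP}}(\omega)$ be the central path induced by $\varphi$ and initialized at $x_{\mathrm{R}}=\arg\min_{x\in\mathcal{X}}\varphi(x)$. Then for all $\omega\in(0,\infty)$, $$D_{\varphi}\left(x_{\mathrm{CP}}(\omega),x_{\mathrm{R}}'(\omega)\right)\le\kappa^2\cdot D_{\varphi}\left(\Pi^{\varphi}_{\mathcal{X}}(0),\Pi^{\varphi}_{\mathrm{Aff}(\mathcal{X})}(0)\right)$$ and $$D_{\varphi}\left(x_{\mathrm{R}}'(\omega),x_{\mathrm{CP}}(\omega)\right)\le\kappa^2\cdot D_{\varphi}\left(\Pi^{\varphi}_{\mathrm{Aff}(\mathcal{X})}(0),\Pi^{\varphi}_{\mathcal{X}}(0)\right).$$ Moreover, the bound is sharp: there exist data $(\mathcal{X},a_0,\mathcal{V},g,\kappa)$, with $\mathcal{X}\subseteq\mathbb{R}^n$ nonempty, closed and convex, $a_0\in\mathbb{R}^n$, $\mathcal{V}\subset\mathbb{R}^n$ compact, smooth and strictly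 convex with $0\in\mathrm{int}(\mathcal{V})$, $g:\mathbb{R}\to[0,\infty)$ Legendre with $g(0)=0$ and $g'(0)=0$, and the Bregman projection induced by $\varphi(\cdot)=g(\|\cdot\|_{\mathcal{V}^{\circ}})$ being $\kappa$-expansive, and some $\omega\in(0,\infty)$ for which the bound holds with equality, with both sides nonzero.
   Context: For a closed convex set $\mathcal{C}\subseteq\mathbb{R}^n$ containing $0$: the gauge is $\|v\|_{\mathcal{C}}=\inf\{t\ge0: v\in t\mathcal{C}\}$ and the polar is $\mathcal{C}^{\circ}=\{y:\langle x,y\rangle\le1\ \forall x\in\mathcal{C}\}$. $\mathrm{Aff}(\mathcal{X})$ is the affine hull. A convex set with nonempty interior is strictly convex if for distinct boundary points the open segment between them lies in the interior; it is smooth if the supporting hyperplane at each boundary point is unique. A proper closed convex function $\psi:\mathbb{R}^n\to\mathbb{R}\cup\{+\infty\}$ is Legendre if $\mathrm{int}(\mathrm{dom}\,\psi)\ne\varnothing$, $\psi$ is differentiable and strictly convex on $\mathrm{int}(\mathrm{dom}\,\psi)$, and $\|\nabla\psi(x_n)\|_2\to\infty$ whenever $x_n\in\mathrm{int}(\mathrm{dom}\,\psi)$ converges to a boundary point of $\mathrm{dom}\,\psi$. Bregman divergence: $D_\varphi(x,y)=\varphi(x)-\varphi(y)-\langle\nabla\varphi(y),x-y\rangle$. Bregman projection onto a closed convex set $\mathcal{S}$: $\Pi^{\varphi}_{\mathcal{S}}(y)=\arg\min_{x\in\mathcal{S}}D_\varphi(x,y)$. The Bregman projection induced by $\varphi$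 is $\kappa$-expansive if for every (nonempty) closed convex $\mathcal{S}$ and all $x,y\in\mathrm{int}(\mathrm{dom}\,\varphi)$, $D_\varphi(\Pi^\varphi_{\mathcal{S}}(x),\Pi^\varphi_{\mathcal{S}}(y))\le\kappa D_\varphi(x,y)$, and in addition, with $d=y-x$, $D_\varphi(\Pi^\varphi_{\mathcal{S}+d}(x),\Pi^\varphi_{\mathcal{S}}(x))\le\kappa D_\varphi(x,y)$. Robust path points: $x_{\mathrm{R}}'(\omega)=\arg\min_{x\in\mathcal{X}}\langle a_0,x\rangle+\omega\varphi(x)$. Central path initialized at $x_{\mathrm{R}}$: $x_{\mathrm{CP}}(\omega)=\arg\min_{x\in\mathcal{X}}\langle a_0,x\rangle+\omega D_\varphi(x,x_{\mathrm{R}})$. These minimizers are taken to exist (they are then unique by strict convexity). *)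

(* Defs.v *)
From HB Require Import structures.
From mathcomp Require Import all_boot all_order all_algebra.
From mathcomp Require Import all_classical all_reals all_analysis.

Set Implicit Arguments.
Unset Strict Implicit.
Unset Printing Implicit Defensive.

Import Order.TTheory GRing.Theory Num.Theory.
Import numFieldNormedType.Exports.

Local Open Scope classical_set_scope.
Local Open Scope ring_scope.

(* R^n is 'rV[R]_n.  Its topology in the library comes from the sup norm and is
   the usual one; the Euclidean norm is defined separately. *)

Section Euclidean.
Context {R : realType} {n : nat}.
Implicit Types (x y u : 'rV[R]_n) (A C : set 'rV[R]_n).

Definition dotv x y : R := \sum_(i < n) x 0 i * y 0 i.

Definition enorm x : R := Num.sqrt (dotv x x).

(* The vector of partial derivatives; it is the gradient wherever f is
   differentiable. *)
Definition grad (f : 'rV[R]_n -> R) x : 'rV[R]_n :=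
  \row_i 'D_(delta_mx 0 i) f x.

Definition affine_set A :=
  forall x y (t : R), A x -> A y -> A ((1 - t) *: x + t *: y).

Definition Aff A : set 'rV[R]_n := smallest affine_set A.

Definition frontier A : set 'rV[R]_n := closure A `\` A°.

(* Valued in the extended reals: ereal_inf of the empty set is +oo. *)
Definition gauge C x : \bar R :=
  ereal_inf [set t%:E | t in [set t : R | 0 <= t /\ [set t *: c | c in C] x]].

Definition polar C : set 'rV[R]_n := [set y | forall x, C x -> dotv x y <= 1].

Definition strictly_convex_set C :=
  [/\ convex_set C, C° !=set0 &
      forall x y, frontier C x -> frontier C y -> x != y ->
        forall t : R, 0 < t < 1 -> C° ((1 - t) *: x + t *: y)].

Definition supporting_hyperplane C x (H : set 'rV[R]_n) :=
  exists u, [/\ u != 0, H = [set y | dotv u y = dotv u x] &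
                forall y, C y -> dotv u y <= dotv u x].

Definition smooth_set C :=
  [/\ convex_set C, C° !=set0 &
      forall x, frontier C x -> exists! H, supporting_hyperplane C x H].

End Euclidean.

Section Legendre.
Context {R : realType} {n : nat}.
Implicit Types psi : 'rV[R]_n -> \bar R.

Definition dom psi : set 'rV[R]_n := [set x | (psi x < +oo)%E].

Definition proper_fun psi := (forall x, (-oo < psi x)%E) /\ dom psi !=set0.

Definition convex_efun psi := forall (x y : 'rV[R]_n) (t : R), 0 < t < 1 ->
  (psi ((1 - t) *: x + t *: y)%R <= (1 - t)%:E * psi x + t%:E * psi y)%E.

Definition strictly_convex_on (D : set 'rV[R]_n) psi :=
  forall (x y : 'rV[R]_n) (t : R), D x -> D y -> x != y -> 0 < t < 1 ->
  (psi ((1 - t) *: x + t *: y)%R < (1 - t)%:E * psi x + t%:E * psi y)%E.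

Definition Legendre psi :=
  [/\ proper_fun psi, lower_semicontinuous psi & convex_efun psi] /\
  [/\ (dom psi)° !=set0,
      forall x, (dom psi)° x -> differentiable (fine \o psi) x,
      strictly_convex_on (dom psi)° psi &
      forall (u : nat -> 'rV[R]_n) (x : 'rV[R]_n),
        (forall k, (dom psi)° (u k)) -> frontier (dom psi) x ->
        u @ \oo --> x ->
        (fun k => enorm (grad (fine \o psi) (u k))) @ \oo --> +oo].

End Legendre.

(* Legendre functions of one real variable, R being identified with R^1. *)
Definition Legendre1 (R : realType) (g : R -> R) :=
  Legendre (fun x : 'rV[R]_1 => (g (x 0 0))%:E).

Section Bregman.
Context {R : realType} {n : nat}.
Implicit Types (phi : 'rV[R]_n -> R) (S X : set 'rV[R]_n) (x y a : 'rV[R]_n).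

(* The set of all minimizers; in the uses below it has at most one element,
   and "p = argmin" is expressed as membership of p. *)
Definition argmin S (f : 'rV[R]_n -> R) : set 'rV[R]_n :=
  [set p | S p /\ forall x, S x -> f p <= f x].

(* phi is finite everywhere, so that int (dom phi) is the whole space. *)
Definition Bregman phi x y : R :=
  phi x - phi y - dotv (grad phi y) (x - y).

Definition Bregman_proj phi S y : set 'rV[R]_n :=
  argmin S (fun x => Bregman phi x y).

Definition expansive phi (kappa : R) :=
  forall S, S !=set0 -> closed S -> convex_set S -> forall x y,
    (forall p q, Bregman_proj phi S x p -> Bregman_proj phi S y q ->
       Bregman phi p q <= kappa * Bregman phi x y) /\
    (forall p q, Bregman_proj phi [set s + (y - x) | s in S] x p ->
       Bregman_proj phi S x q ->
       Bregman phi p q <= kappa * Bregman phi x y).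

Definition robust_path X a phi (w : R) : set 'rV[R]_n :=
  argmin X (fun x => dotv a x + w * phi x).

Definition central_path X a phi x0 (w : R) : set 'rV[R]_n :=
  argmin X (fun x => dotv a x + w * Bregman phi x x0).

(* The gauge of the polar of a compact set V with 0 in its interior is finite,
   so that fine loses nothing. *)
Definition radial (g : R -> R) (V : set 'rV[R]_n) : 'rV[R]_n -> R :=
  fun x => g (fine (gauge (polar V) x)).

End Bregman.

(* Main.v *)
Require Import Defs.
From HB Require Import structures.
From mathcomp Require Import all_boot all_order all_algebra.
From mathcomp Require Import all_classical all_reals all_analysis.
From mathcomp Require Import ring lra.

Set Implicit Arguments.
Unset Strict Implicit.
Unset Printing Implicit Defensive.

Import Order.TTheory GRing.Theory Num.Theory.
Import numFieldNormedType.Exports.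

Local Open Scope classical_set_scope.
Local Open Scope ring_scope.

(** Write [c = a0 / omega], [p] for the projection of [0] onto [X] and [q] for
    its projection onto [Aff X].  Since [phi] has its minimum at [0], where its
    gradient vanishes, [p] is also the starting point [xR].  The gradient at [q]
    is orthogonal to every direction of [Aff X], so it may be added to the
    objective: the robust point [r] minimises over [X] the function
    [<c, .> + D(., q)], while the central point [x] minimises [<c, .> + D(., p)].
    The two problems differ only in the base point.  Adding their optimality
    conditions gives, with [v = grad phi p - grad phi q] and [d = x - r],
<<
      D(x, r) + D(r, x) <= <v, d>.
>>
    It remains to bound the right-hand side by Fenchel-Young duality, and this
    is where expansiveness enters.  Applied to singletons, it says
    [D(s + d, s) <= kappa * D(z, z + d)] for all [s], [z], [d]: the increments
    of the gradient along a given direction are the same everywhere up to the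
    factor [kappa], as if all Hessians of [phi] were comparable
    ([expansive_singleton], [slope_le]).  Cutting segments into small pieces
    upgrades this to a comparison at different scales, with the exponent of a
    quadratic ([Bregman_scale]):
<<
      D(p + t d, p) <= kappa t^2 D(z + d, z).
>>
    Taking [t = 1 / kappa] in
    [<v, d> <= kappa * (D(p - d / kappa, p) + D(p, q))] turns the first term
    into at most [D(r, x)], whence [D(x, r) <= kappa * D(p, q)]
    ([Bregman_transport]); the reversed inequality is obtained with [q] as base
    point.  As [kappa >= 1], this implies the bound with [kappa ^+ 2].

    The analytic input is that [phi] has directional derivatives given by its
    gradient ([radial_gateaux]).  The gauge of the polar of [V] is the support
    function of [V]; strict convexity makes the maximising point of [V] unique,
    and this point is then the gradient of the support function.

    Equality holds for the Euclidean ball with [g t = t ^+ 2], for which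
    [D(x, y)] is the squared distance and projections are nonexpansive
    ([kappa = 1]), with [X] a half-space at distance [1] from [0] and a linear
    objective pushing into it ([sharp_halfspace]). *)

(** * Dot product and convex sets *)

Section DotProduct.
Context {R : realType} {n : nat}.
Implicit Types x y z : 'rV[R]_n.

Lemma dotvC x y : dotv x y = dotv y x.
Proof. by apply: eq_bigr => i _; rewrite mulrC. Qed.

Lemma dotvDl x y z : dotv (x + y) z = dotv x z + dotv y z.
Proof. by rewrite -big_split; apply: eq_bigr => i _; rewrite mxE mulrDl. Qed.

Lemma dotvZl (a : R) x y : dotv (a *: x) y = a * dotv x y.
Proof. by rewrite mulr_sumr; apply: eq_bigr => i _; rewrite mxE mulrA. Qed.

Lemma dotvNl x y : dotv (- x) y = - dotv x y.
Proof. by rewrite -scaleN1r dotvZl mulN1r. Qed.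

Lemma dotvDr x y z : dotv z (x + y) = dotv z x + dotv z y.
Proof. by rewrite dotvC dotvDl !(dotvC z). Qed.

Lemma dotvZr (a : R) x y : dotv x (a *: y) = a * dotv x y.
Proof. by rewrite dotvC dotvZl dotvC. Qed.

Lemma dotvNr x y : dotv x (- y) = - dotv x y.
Proof. by rewrite dotvC dotvNl dotvC. Qed.

Lemma dot0v x : dotv 0 x = 0.
Proof. by rewrite -(scale0r 0) dotvZl mul0r. Qed.

Lemma dotv0 x : dotv x 0 = 0.
Proof. by rewrite dotvC dot0v. Qed.

Definition dotvE := (dotvDl, dotvDr, dotvNl, dotvNr, dotvZl, dotvZr).

Lemma dotv_ge0 x : 0 <= dotv x x.
Proof. by apply: sumr_ge0 => i _; rewrite -expr2 sqr_ge0. Qed.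

Lemma dotv_eq0 x : (dotv x x == 0) = (x == 0).
Proof.
apply/idP/eqP => [|->]; last by rewrite dotv0.
rewrite psumr_eq0 => [/allP x0|i _]; last by rewrite -expr2 sqr_ge0.
apply/rowP => i; apply/eqP; rewrite mxE -sqrf_eq0 expr2.
by have := x0 i; rewrite mem_index_enum => /(_ isT).
Qed.

Lemma dotv_gt0 x : x != 0 -> 0 < dotv x x.
Proof. by move=> x0; rewrite lt_def dotv_ge0 dotv_eq0 x0. Qed.

Lemma dotv_delta x i : dotv x (delta_mx 0 i) = x 0 i.
Proof.
rewrite /dotv (bigD1 i)//= mxE !eqxx mulr1 big1 ?addr0// => j ji.
by rewrite mxE eqxx (negPf ji) mulr0.
Qed.

Lemma dotv_continuous y : continuous (fun x => dotv x y).
Proof.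
apply: continuous_big => [|i _ x]; first exact: add_continuous.
have c : {for x, continuous (fun v : 'rV[R]_n => v 0 i)}.
  exact: coord_continuous.
have c' : {for x, continuous (fun v : 'rV[R]_n => y 0 i)} by exact: cst_continuous.
have cc' := continuousM c c'.
exact: cc'.
Qed.

Lemma sqnorm_continuous : continuous (fun x => dotv x x).
Proof.
apply: continuous_big => [|i _ x]; first exact: add_continuous.
have c : {for x, continuous (fun v : 'rV[R]_n => v 0 i)}.
  exact: coord_continuous.
exact: (continuousM c c).
Qed.

(** The library phrases convexity with bundled weights; this is the unbundled
    form, in both directions. *)
Lemma convex_setP (C : set 'rV[R]_n) : convex_set C ->
  forall x y (t : R), C x -> C y -> 0 <= t <= 1 -> C ((1 - t) *: x + t *: y).
Proof.
move=> cC x y t Cx Cy /andP[t0 t1].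
pose l : {i01 R} := Itv01 t0 t1.
have := cC y x l; rewrite !inE => /(_ Cy Cx).
by rewrite addrC.
Qed.

Lemma convex_set_intro (C : set 'rV[R]_n) :
  (forall x y (t : R), C x -> C y -> 0 <= t <= 1 ->
     C ((1 - t) *: x + t *: y)) -> convex_set C.
Proof.
move=> cC x y l; rewrite !inE => Cx Cy.
have := cC y x l%:num Cy Cx; rewrite ge0 le1 => /(_ isT).
by rewrite addrC.
Qed.

End DotProduct.

(** * Directional derivatives *)

Section OneSided.
Context {R : realType}.
Implicit Types (f : R -> R) (l b : R).

(** Clearing the denominator of the difference quotient removes the punctured
    neighbourhood. *)
Lemma is_derive0P f l : is_derive (0 : R) (1 : R) f l <->
  (forall e, 0 < e -> \forall t \near (0 : R), `|f t - f 0 - t * l| <= e * `|t|).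
Proof.
pose q (h : R) := h^-1 *: ((f \o shift 0) (h *: 1) - f 0).
have qE h : q h = h^-1 * (f h - f 0).
  by rewrite /q /= addr0 [_%:A]mulr1.
have dq h : h != 0 -> `|f h - f 0 - h * l| = `|l - q h| * `|h|.
  move=> h0; rewrite -normrM qE mulrBl mulrAC mulVf// mul1r distrC.
  by congr (`|_|); ring.
split=> [[df dfl] e e0|fl].
  have : q h @[h --> 0^'] --> l by rewrite -dfl; exact: df.
  move=> /cvgrPdist_le/(_ _ e0)/=; rewrite near_withinE; apply: filterS => t H.
  have [->|t0] := eqVneq t 0.
    by rewrite subrr mul0r subr0 normr0 mulr0.
  by rewrite dq// ler_wpM2r// H.
suff ql : q h @[h --> 0^'] --> l.
  apply: DeriveDef; first by apply/cvg_ex; exists l.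
  exact/cvg_lim.
apply/cvgrPdist_le => e e0; rewrite near_withinE.
apply: filterS (fl _ e0) => t + t0.
by rewrite dq// ler_pM2r ?normr_gt0.
Qed.

Lemma is_derive_right_le f l b : is_derive (0 : R) (1 : R) f l ->
  (forall t, 0 < t < 1 -> f t <= f 0 + t * b) -> l <= b.
Proof.
move=> /is_derive0P fl fb; rewrite leNgt; apply/negP => bl.
have e0 : 0 < (l - b) / 2 by rewrite divr_gt0// subr_gt0.
have /nbhs_ballP[d/= d0 H] := fl _ e0.
pose t := Num.min (d / 2) (1 / 2).
have t0 : 0 < t by rewrite lt_min !divr_gt0.
have td : t < d by rewrite gt_min; apply/orP; left; lra.
have t1 : t < 1 by rewrite gt_min; apply/orP; right; lra.
have := H t; rewrite /ball/= sub0r normrN gtr0_norm// => /(_ td).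
rewrite ler_norml => /andP[+ _].
have := fb t; rewrite t0 t1 => /(_ isT) ? ?.
have : t * (l - b) <= 0 by lra.
by rewrite pmulr_rle0// subr_le0 leNgt bl.
Qed.

End OneSided.

Section Lines.
Context {R : realType} {n : nat}.
Implicit Types (f : 'rV[R]_n -> R) (x h : 'rV[R]_n).

Lemma is_derive_line f x h l :
  is_derive x h f l <-> is_derive (0 : R) (1 : R) (fun t => f (x + t *: h)) l.
Proof.
have E : (fun k : R => k^-1 *: (((fun t => f (x + t *: h)) \o shift 0) (k *: 1)
    - f (x + 0 *: h))) = (fun k : R => k^-1 *: ((f \o shift x) (k *: h) - f x)).
  apply/funext => k /=.
  by rewrite addr0 scale0r addr0 (addrC x) [k%:A]mulr1.
split=> -[df dl]; apply: DeriveDef.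
- by rewrite /derivable E.
- by rewrite -dl /derive E.
- by move: df; rewrite /derivable E.
- by rewrite -dl /derive E.
Qed.

(** Weaker than differentiability, but all that the optimality conditions and
    the integration of gradients along segments require. *)
Definition gateaux f := forall x h, is_derive x h f (dotv (grad f x) h).

Lemma gateaux_intro f (G : 'rV[R]_n -> 'rV[R]_n) :
  (forall x h, is_derive x h f (dotv (G x) h)) -> grad f = G /\ gateaux f.
Proof.
move=> fG; suff gE : grad f = G by split => // x h; rewrite gE.
apply/funext => x; apply/rowP => i.
by rewrite mxE derive_val dotv_delta.
Qed.

Lemma gateaux_line f x h (t : R) : gateaux f ->
  is_derive t (1 : R) (fun s => f (x + s *: h)) (dotv (grad f (x + t *: h)) h).
Proof.
move=> /(_ (x + t *: h) h); set l := dotv _ _; move=> [df dl].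
have E : (fun k : R => k^-1 *: (((fun s => f (x + s *: h)) \o shift t) (k *: 1)
    - f (x + t *: h))) =
   (fun k : R => k^-1 *: ((f \o shift (x + t *: h)) (k *: h) - f (x + t *: h))).
  apply/funext => k /=; congr (_ *: (f _ - _)).
  by rewrite scalerDl [k%:A]mulr1 addrCA.
by apply: DeriveDef; rewrite -?dl ?/derive ?/derivable E.
Qed.

Lemma gateaux_le f x h b : gateaux f ->
  (forall t : R, 0 < t < 1 -> f (x + t *: h) <= f x + t * b) ->
  dotv (grad f x) h <= b.
Proof.
move=> gf fb; apply: (is_derive_right_le (f := fun t => f (x + t *: h))).
  by apply/is_derive_line; exact: gf.
by move=> t t01; rewrite scale0r addr0; exact: fb.
Qed.

Lemma gateaux_ge f x h b : gateaux f ->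
  (forall t : R, 0 < t < 1 -> f x + t * b <= f (x + t *: h)) ->
  b <= dotv (grad f x) h.
Proof.
move=> gf fb; rewrite -lerN2.
apply: (is_derive_right_le (f := fun t => - f (x + t *: h))).
  by apply: is_deriveN; apply/is_derive_line; exact: gf.
by move=> t t01; rewrite scale0r addr0 mulrN -opprD lerN2; exact: fb.
Qed.

Definition convex_fun f := forall x y (t : R), 0 < t < 1 ->
  f ((1 - t) *: x + t *: y) <= (1 - t) * f x + t * f y.

Lemma Bregman_ge0 f x y : gateaux f -> convex_fun f -> 0 <= Bregman f x y.
Proof.
move=> gf cf; rewrite /Bregman subr_ge0; apply: gateaux_le => // t t01.
have -> : y + t *: (x - y) = (1 - t) *: y + t *: x.
  by rewrite scalerBr scalerBl scale1r addrCA addrC.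
by apply: le_trans (cf _ _ _ t01) _; rewrite le_eqVlt; apply/orP; left; apply/eqP; ring.
Qed.

End Lines.

(** * Bregman divergences of functions with comparable gradient increments *)

Section Comparison.
Context {R : realType} {n : nat}.
Variables (f : 'rV[R]_n -> R) (k : R).
Hypotheses (gf : gateaux f) (D0 : forall x y, 0 <= Bregman f x y) (k0 : 0 < k).
Hypothesis fk : forall s x d, Bregman f (s + d) s <= k * Bregman f x (x + d).
Implicit Types x y s d : 'rV[R]_n.

(** The symmetrised divergence [D(x + d, x) + D(x, x + d)], see [slopeE];
    unlike the divergence it is additive along a segment. *)
Definition slope x d := dotv (grad f (x + d) - grad f x) d.

Lemma slopeE x d : slope x d = Bregman f (x + d) x + Bregman f x (x + d).
Proof.
have e1 : x + d - x = d by rewrite addrC addKr.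
have e2 : x - (x + d) = - d by rewrite opprD addNKr.
rewrite /slope /Bregman e1 e2.
by rewrite !dotvE; ring.
Qed.

Lemma slope_ge0 x d : 0 <= slope x d.
Proof. by rewrite slopeE addr_ge0. Qed.

(** The hypothesis bounds [D(s + d, s)] and, with [d] reversed, [D(s, s + d)];
    the two bounds add up. *)
Lemma slope_le s x d : slope s d <= k * slope x d.
Proof.
rewrite !slopeE mulrDr [leRHS]addrC lerD//.
by have := fk (s + d) (x + d) (- d); rewrite !addrK.
Qed.

Lemma slope_subdivide x d m :
  \sum_(i < m) dotv (grad f (x + i.+1%:R *: d) - grad f (x + i%:R *: d)) d
  = dotv (grad f (x + m%:R *: d) - grad f x) d.
Proof.
elim: m => [|m IH]; first by rewrite big_ord0 scale0r addr0 subrr dot0v.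
by rewrite big_ord_recr/= IH -dotvDl; congr (dotv _ d); rewrite addrC subrKA.
Qed.

Lemma slope_scaled x d (r : R) : 0 < r ->
  dotv (grad f (x + r *: d) - grad f x) d = r^-1 * slope x (r *: d).
Proof.
by move=> r0; rewrite /slope dotvZr mulrA mulVf ?mul1r// gt_eqF.
Qed.

Lemma le_add_inv (a b c : R) :
  (forall N, a <= b + c * N.+1%:R^-1) -> a <= b.
Proof.
move=> H; apply/ler_addgt0Pr => e e0.
apply: le_trans (H (Num.truncn (`|c| / e))) _; rewrite lerD2l.
have N0 : 0 < (Num.truncn (`|c| / e)).+1%:R :> R by [].
rewrite ler_pdivrMr//; apply: le_trans (ler_norm c) _.
rewrite mulrC -ler_pdivrMr//.
have c0 : 0 <= `|c| / e by rewrite divr_ge0// ltW.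
by have /andP[_ /ltW] := truncn_itv c0.
Qed.

Lemma sum_cst (m : nat) (a : R) : \sum_(i < m) a = m%:R * a.
Proof. by rewrite sumr_const card_ord mulr_natl. Qed.

(** Each of the [m] steps near [s] is at most [k] times each of the [N] steps
    near [x], hence at most [k] times their average. *)
Lemma slope_steps s x e m N :
  N%:R * dotv (grad f (s + m%:R *: e) - grad f s) e <=
  k * m%:R * dotv (grad f (x + N%:R *: e) - grad f x) e.
Proof.
have stepE y i : y + i.+1%:R *: e = y + i%:R *: e + e.
  by rewrite -natr1 scalerDl scale1r addrA.
have one y : N%:R * slope y e <=
    k * dotv (grad f (x + N%:R *: e) - grad f x) e.
  rewrite -(sum_cst N) -slope_subdivide mulr_sumr.
  by apply: ler_sum => i _; rewrite stepE; exact: slope_le.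
rewrite [leRHS]mulrAC [leRHS]mulrC -(sum_cst m) -slope_subdivide mulr_sumr.
by apply: ler_sum => i _; rewrite stepE; exact: one.
Qed.

(** [slope_steps] is this inequality for [t = m / N], and the left-hand side
    increases with [t].  Rounding [t] up to a multiple of [1 / N] costs a term
    of order [1 / N]. *)
Lemma slope_scale s x d (t : R) : 0 <= t ->
  dotv (grad f (s + t *: d) - grad f s) d <= k * t * slope x d.
Proof.
move=> t0; apply: (@le_add_inv _ _ (k * slope x d)) => N'.
set N := N'.+1; have N0 : 0 < N%:R :> R by [].
have [e de] : exists e, d = N%:R *: e.
  by exists (N%:R^-1 *: d); rewrite scalerA divff ?scale1r// gt_eqF.
(* [m / N] is the multiple of [1 / N] just above [t] *)
set m := (Num.truncn (t * N%:R)).+1.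
have /andP[tm mt] : (m%:R <= t * N%:R + 1) && (t * N%:R < m%:R).
  have /truncn_itv/andP[h1 h2] : 0 <= t * N%:R by rewrite mulr_ge0// ltW.
  by rewrite h2 andbT -natr1 lerD2r.
apply: (@le_trans _ _ (dotv (grad f (s + m%:R *: e) - grad f s) d)).
  pose r := m%:R / N%:R - t.
  have r0 : 0 < r by rewrite subr_gt0 ltr_pdivlMr.
  have -> : s + m%:R *: e = s + t *: d + r *: d.
    by rewrite -addrA -scalerDl de scalerA subrKC divfK// gt_eqF.
  have : 0 <= dotv (grad f (s + t *: d + r *: d) - grad f (s + t *: d)) d.
    by rewrite slope_scaled// mulr_ge0 ?slope_ge0// invr_ge0 ltW.
  by rewrite !dotvDl !dotvNl; lra.
rewrite {1}de dotvZr; apply: le_trans (slope_steps s x e m N) _.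
set S := slope x d.
have -> : k * t * S + k * S / N%:R = k * ((t + N%:R^-1) * S) by ring.
rewrite -mulrA ler_pM2l// /S.
have -> : slope x d = N%:R * dotv (grad f (x + N%:R *: e) - grad f x) e.
  by rewrite /slope -dotvZr -de.
rewrite mulrA; apply: ler_wpM2r.
  by rewrite -(pmulr_rge0 _ N0) -dotvZr -de slope_ge0.
by rewrite mulrDl mulVf// gt_eqF.
Qed.

(** [slope_scale] compares the derivatives, with respect to [u], of
    [D(p + u t d, p)] and of [k t^2 D(x + u d, x)]; both functions vanish at
    [u = 0]. *)
Lemma Bregman_scale p x d (t : R) : 0 < t ->
  Bregman f (p + t *: d) p <= k * t ^+ 2 * Bregman f (x + d) x.
Proof.
move=> t0.
pose c := k * t ^+ 2 * dotv (grad f x) d - dotv (grad f p) (t *: d).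
pose F (u : R) := k * t ^+ 2 * f (x + u *: d) - f (p + u *: (t *: d)) - c * u.
pose F' (u : R) := k * t ^+ 2 * dotv (grad f (x + u *: d)) d
  - dotv (grad f (p + u *: (t *: d))) (t *: d) - c.
have dF (u : R) : is_derive u 1 F (F' u).
  have h1 := gateaux_line x d u gf.
  have h2 := gateaux_line p (t *: d) u gf.
  have h3 := is_deriveZ c (is_derive_id u 1).
  have H := is_deriveB (is_deriveB (is_deriveZ (k * t ^+ 2) h1) h2) h3.
  by apply: (is_derive_eq H); congr (_ - _); rewrite [c *: 1]mulr1.
have F'0 (u : R) : 0 < u -> 0 <= F' u.
  move=> u0.
  have := slope_scale p x (u *: d) (ltW t0).
  rewrite /F' /c /slope !scalerA !dotvE (mulrC u t).
  set a1 := dotv _ d; set a2 := dotv _ d; set a3 := dotv _ d; set a4 := dotv _ d.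
  move=> H.
  have {}H : u * (a1 - a2) <= u * (k * t * (a3 - a4)).
    by move: H; congr (_ <= _); ring.
  rewrite ler_pM2l// in H.
  have := ler_wpM2l (ltW t0) H.
  by rewrite -subr_ge0; congr (_ <= _); ring.
have [|w w01 ] := MVT_segment ler01 (fun u _ => dF u).
  apply: continuous_subspaceT => u.
  by apply/differentiable_continuous/derivable1_diffP/ex_derive.
rewrite subr0 mulr1 => E.
have F01 : 0 <= F 1 - F 0.
  rewrite E; have [->|w0] := eqVneq w 0.
    by rewrite /F' /c !scale0r !addr0 subrr.
  by apply: F'0; move: w01; rewrite in_itv/= lt_def w0 => /andP[].
have e1 y v : y + v - y = v :> 'rV[R]_n by rewrite addrC addKr.
rewrite -subr_ge0; move: F01; congr (_ <= _).
by rewrite /F /c /Bregman !e1 !scale1r !scale0r !addr0; ring.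
Qed.

(** The three-point identity and [0 <= D(p - d / k, q)], with [d = x - r], give
    [<v, d> <= k D(p - d / k, p) + k D(p, q)] for [v = grad f p - grad f q].
    The scaling [1 / k] is the one for which [Bregman_scale] absorbs the first
    term in [D(r, x)]. *)
Lemma Bregman_transport p q x r : 1 <= k ->
  Bregman f x r + Bregman f r x <= dotv (grad f p - grad f q) (x - r) ->
  Bregman f x r <= k * Bregman f p q /\ Bregman f r x <= k * Bregman f q p.
Proof.
move=> k1 H.
have k2 : k * k^-1 ^+ 2 = k^-1 by rewrite expr2 mulrA divff ?mul1r// gt_eqF.
have three a b c : Bregman f a c =
    Bregman f a b + Bregman f b c + dotv (grad f b - grad f c) (a - b).
  by rewrite /Bregman !dotvE; ring.
have ki : 0 < k^-1 by rewrite invr_gt0.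
have bound a z d : k * Bregman f (a + k^-1 *: d) a <= Bregman f (z + d) z.
  have := Bregman_scale a z d ki; rewrite k2 => /(ler_wpM2l (ltW k0)).
  by rewrite mulrA divff ?mul1r// gt_eqF.
have e1 y v : y + v - y = v :> 'rV[R]_n by rewrite addrC addKr.
split.
- have b1 := bound p x (r - x).
  have := D0 (p + k^-1 *: (r - x)) q.
  rewrite (three _ p) e1 dotvZr -(ler_pM2l k0) mulr0 mulrDr.
  rewrite (mulrDr k (Bregman f _ p)) mulrA.
  rewrite divff ?gt_eqF// mul1r => b2.
  have e : dotv (grad f p - grad f q) (r - x) =
      - dotv (grad f p - grad f q) (x - r).
    by rewrite -dotvNr opprB.
  rewrite e in b2.
  rewrite (addrC x) subrK in b1; move: b1 b2 H; lra.
- have b1 := bound q r (x - r).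
  have := D0 (q + k^-1 *: (x - r)) p.
  rewrite (three _ q) e1 dotvZr -(ler_pM2l k0) mulr0 mulrDr.
  rewrite (mulrDr k (Bregman f _ q)) mulrA.
  rewrite divff ?gt_eqF// mul1r -(opprB (grad f p)) dotvNl => b2.
  rewrite (addrC r) subrK in b1; move: b1 b2 H; lra.
Qed.

End Comparison.

(** * The support function *)

Section SupportFunction.
Context {R : realType} {n : nat}.
Variable V : set 'rV[R]_n.
Hypotheses (cptV : compact V) (V0 : V° 0).
Implicit Types x h u v : 'rV[R]_n.

Lemma interior_ray v h : V° v -> exists2 e : R, 0 < e & V (v + e *: h).
Proof.
move=> Vv.
have c : {for 0, continuous (fun t : R => v + t *: h)}.
  apply: continuousD; first exact: cst_continuous.
  exact: scalel_continuous.
have : \forall t \near (0 : R), V (v + t *: h).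
  by apply: c; rewrite scale0r addr0.
move=> /nbhs_ballP[d /= d0 H]; exists (d / 2); first by rewrite divr_gt0.
apply: H; rewrite /ball/= sub0r normrN gtr0_norm ?divr_gt0//.
by rewrite ltr_pdivrMr// mulr_natr mulr2n ltrDl.
Qed.

Definition support x := fine (gauge (polar V) x).

Lemma dotv_within y (A : set 'rV[R]_n) :
  {within A, continuous (fun x => dotv x y)}.
Proof. exact/continuous_subspaceT/dotv_continuous. Qed.

(** The gauge of the polar is the support function: [x] lies in [t] times the
    polar of [V] exactly when [dotv u x <= t] on [V], at least for [0 < t].
    Since [0] is interior to [V], the case [t = 0] only arises for [x = 0]. *)
Lemma supportP x : exists v,
  [/\ V v, support x = dotv v x & forall u, V u -> dotv u x <= support x].
Proof.
have Vn0 : V !=set0 by exists 0; exact: interior_subset.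
have [v /set_mem Vv vmax] := EVT_max_rV Vn0 cptV (@dotv_within x V).
have {}vmax u : V u -> dotv u x <= dotv v x by move=> Vu; apply/vmax/mem_set.
have v0 : 0 <= dotv v x.
  by rewrite -(dot0v x); apply/vmax; exact: interior_subset.
suff gE : gauge (polar V) x = (dotv v x)%:E.
  by exists v; split => //; rewrite /support gE.
apply/eqP; rewrite eq_le; apply/andP; split.
  apply: ereal_inf_lbound; exists (dotv v x) => //; split => //.
  have [x0|x0] := eqVneq x 0.
    exists 0; last by rewrite x0 scaler0.
    by move=> u _; rewrite dotv0.
  have vx : 0 < dotv v x.
    have [e e0 Vex] := interior_ray x V0.
    apply: lt_le_trans (vmax _ Vex).
    by rewrite add0r dotvZl mulr_gt0// dotv_gt0.
  exists ((dotv v x)^-1 *: x); last by rewrite scalerA divff ?scale1r// gt_eqF.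
  by move=> u Vu; rewrite dotvZr mulrC ler_pdivrMr// mul1r vmax.
apply: le_ereal_inf_tmp => _ [t [t0 [c Vc tcx]] <-].
by rewrite lee_fin -tcx dotvZr ler_piMr// Vc.
Qed.

Lemma support_ge0 x : 0 <= support x.
Proof.
have [v [_ _ /(_ 0)]] := supportP x.
by rewrite dot0v; apply; exact: interior_subset.
Qed.

Lemma support_gt0 x : x != 0 -> 0 < support x.
Proof.
move=> x0; have [e e0 Vex] := interior_ray x V0.
have [v [_ _ /(_ _ Vex)]] := supportP x; apply: lt_le_trans.
by rewrite add0r dotvZl mulr_gt0// dotv_gt0.
Qed.

Lemma supportZ (t : R) x : 0 <= t -> support (t *: x) = t * support x.
Proof.
move=> t0; have [v [Vv -> vm]] := supportP x.
have [w [Vw sE wm]] := supportP (t *: x).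
apply/eqP; rewrite eq_le -{2}dotvZr wm// andbT sE dotvZr ler_wpM2l//.
by have := vm w Vw.
Qed.

Lemma support0 : support 0 = 0.
Proof. by have [v [_ -> _]] := supportP 0; rewrite dotv0. Qed.

Lemma support_convex x y (t : R) : 0 < t < 1 ->
  support ((1 - t) *: x + t *: y) <= (1 - t) * support x + t * support y.
Proof.
move=> /andP[t0 t1]; have [v [Vv -> _]] := supportP ((1 - t) *: x + t *: y).
rewrite dotvDr !dotvZr; apply: lerD; apply: ler_wpM2l; rewrite ?subr_ge0 ?(ltW t0) ?(ltW t1)//.
- by have [w [_ _ /(_ _ Vv)]] := supportP x.
- by have [w [_ _ /(_ _ Vv)]] := supportP y.
Qed.

(** A maximiser of a nonzero functional lies on the frontier, and the midpoint
    of two maximisers is again one; strict convexity puts that midpoint in the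
    interior, where a nonzero functional has no maximum. *)
Lemma support_face_unique x u v : strictly_convex_set V -> x != 0 ->
  V u -> V v -> dotv u x = support x -> dotv v x = support x -> u = v.
Proof.
move=> [_ _ sV] x0 Vu Vv ux vx; apply/eqP/negPn/negP => uv.
have notint w : dotv w x = support x -> ~ V° w.
  move=> wx Vw; have [e e0 We] := interior_ray x Vw.
  have [z [_ _ /(_ _ We)]] := supportP x.
  by rewrite dotvDl dotvZl wx gerDl leNgt mulr_gt0// dotv_gt0.
have fr w : V w -> dotv w x = support x -> frontier V w.
  by move=> Vw wx; split; [exact: subset_closure | exact: notint].
have half : (0 < 2^-1 :> R) && (2^-1 < 1 :> R) by lra.
have := sV u v (fr _ Vu ux) (fr _ Vv vx) uv 2^-1 half.
by apply: notint; rewrite dotvDl !dotvZl ux vx; field.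
Qed.

(** Near [x], a maximiser for [x + t *: h] must be close to the unique
    maximiser [v] for [x] when tested against [h]: on the compact set of those
    [w] in [V] with [e <= `|dotv w h - dotv v h|] the functional [dotv _ x]
    stays a fixed amount below its maximum. *)
Lemma support_gap x h v e : V v -> dotv v x = support x ->
  (forall w, V w -> dotv w x = support x -> w = v) -> 0 < e ->
  exists2 eta : R, 0 < eta & forall w, V w ->
    e <= `|dotv w h - dotv v h| -> dotv w x <= support x - eta.
Proof.
move=> Vv vx uniq e0.
pose K := V `&` [set w | e <= `|dotv w h - dotv v h|].
have cK : compact K.
  apply: compact_closedI => //.
  have c : continuous (fun w : 'rV[R]_n => `|dotv w h - dotv v h|).
    move=> w; apply: (@continuous_comp _ _ _ (fun w => dotv w h - dotv v h)).
      apply: (@continuousB _ R^o _ (fun w => dotv w h) (fun=> dotv v h)).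
        exact: dotv_continuous.
      exact: cst_continuous.
    exact: norm_continuous.
  have := @preimage_closed _ _ _ [set y | e <= y] (fun w _ => c w) (@closed_ge _ e).
  exact.
have [K0|] := pselect (K !=set0); last first.
  by move=> K0; exists 1 => // w Vw we; case: K0; exists w.
have [w /set_mem[Vw we] wm] := EVT_max_rV K0 cK (@dotv_within x K).
have [z [_ _ sm]] := supportP x.
exists (support x - dotv w x) => [|u Vu ue].
  rewrite subr_gt0 lt_neqAle sm// andbT; apply/eqP => /(uniq _ Vw) wv.
  by move: we; rewrite /= wv subrr normr0 leNgt e0.
by rewrite opprB addrCA subrr addr0; apply/wm/mem_set.
Qed.

(** If [w] maximises the functional given by [x + t *: h], the increment of the
    support function lies between [t * dotv v h] and [t * dotv w h].  By
    [support_gap], [dotv w h] is within [e] of [dotv v h] once the perturbation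
    by [t *: h] moves values on [V] by less than half the gap. *)
Lemma support_is_derive x h v : strictly_convex_set V -> x != 0 ->
  V v -> dotv v x = support x -> is_derive x h support (dotv v h).
Proof.
move=> sV x0 Vv vx; apply/is_derive_line/is_derive0P => e e0 /=.
have uniq w : V w -> dotv w x = support x -> w = v.
  by move=> Vw wx; apply: support_face_unique vx.
have [eta eta0 gap] := support_gap h Vv vx uniq e0.
have [a [Va sa am]] := supportP h.
have [b [Vb sb bm]] := supportP (- h).
pose M := support h + support (- h) + 1.
have M0 : 0 < M by rewrite ltr_wpDl// addr_ge0// support_ge0.
have hM w : V w -> `|dotv w h| < M.
  move=> Vw; rewrite ltr_norml /M.
  have := am w Vw; have := bm w Vw; rewrite dotvNr.
  by have := support_ge0 h; have := support_ge0 (- h); lra.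
have d0 : 0 < eta / (2 * M) by rewrite divr_gt0// mulr_gt0.
apply/nbhs_ballP; exists (eta / (2 * M)) => //= t.
rewrite /ball/= sub0r normrN => td.
have [w [Vw sw wm]] := supportP (x + t *: h).
have [z [_ _ sm]] := supportP x.
have lo : support x + t * dotv v h <= support (x + t *: h).
  by rewrite -vx -dotvZr -dotvDr wm.
have hi : support (x + t *: h) <= support x + t * dotv w h.
  by rewrite sw dotvDr dotvZr lerD2r sm.
have tM u : V u -> `|t * dotv u h| < eta / 2.
  move=> Vu; rewrite normrM.
  have /le_lt_trans : `|t| * `|dotv u h| <= `|t| * M.
    by rewrite ler_wpM2l// ltW// hM.
  apply; move: td; rewrite ltr_pdivlMr ?mulr_gt0// => td.
  by rewrite ltr_pdivlMr// mulrAC -mulrA.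
have we : `|dotv w h - dotv v h| < e.
  rewrite ltNge; apply/negP => /(gap w Vw) gw.
  have := tM _ Vw; have := tM _ Vv; rewrite !ltr_norml => /andP[? ?] /andP[? ?].
  have : support (x + t *: h) <= support x - eta + t * dotv w h.
    by rewrite sw dotvDr dotvZr lerD2r.
  by lra.
rewrite scale0r addr0 ger0_norm; last by rewrite -addrA -opprD subr_ge0.
apply: (@le_trans _ _ (t * (dotv w h - dotv v h))).
  by rewrite mulrBr; lra.
apply: le_trans (ler_norm _) _.
by rewrite normrM mulrC ler_wpM2r// ltW.
Qed.

End SupportFunction.

(** * Radial functions *)

Section Profile.
Context {R : realType}.
Variable g : R -> R.
Hypotheses (gL : Legendre1 g) (gge0 : forall t, 0 <= g t) (g0 : g 0 = 0).

Let G (x : 'rV[R]_1) : \bar R := (g (x 0 0))%:E.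

Lemma dom_profile : (dom G)° = setT.
Proof.
have -> : dom G = setT by apply/seteqP; split => // x _; rewrite /dom /= ltry.
exact: interiorT.
Qed.

Lemma profile_derivable t : derivable g t 1.
Proof.
have [_ [_ dg _ _]] := gL.
have /diff_derivable : differentiable (fine \o G) (const_mx t : 'rV[R]_1).
  by apply: dg; rewrite dom_profile.
move=> /(_ (const_mx 1)); rewrite /derivable.
set q1 := fun h => _; set q2 := fun h => _.
suff -> : q1 = q2 by [].
by apply/funext => h; rewrite /q1 /q2/= !mxE.
Qed.

Lemma profile_convex x y (t : R) : 0 < t < 1 ->
  g ((1 - t) * x + t * y) <= (1 - t) * g x + t * g y.
Proof.
have [[_ _ cg] _] := gL.
move=> /(cg (const_mx x) (const_mx y)).
by rewrite /= !mxE -!EFinM -EFinD lee_fin.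
Qed.

(** Otherwise strict convexity would make [g] negative halfway to [0]. *)
Lemma profile_gt0 x : x != 0 -> 0 < g x.
Proof.
have [_ [_ _ sg _]] := gL => x0.
have half : (0 < 2^-1 :> R) && (2^-1 < 1 :> R) by lra.
have := sg (const_mx x) (const_mx 0) 2^-1.
rewrite dom_profile => /(_ I I) H.
have /H/(_ half) : (const_mx x : 'rV[R]_1) != const_mx 0.
  by apply: contra x0 => /eqP/matrixP/(_ 0 0); rewrite !mxE => ->.
rewrite /= !mxE -!EFinM -EFinD lte_fin g0 !mulr0 !addr0 => /(le_lt_trans (gge0 _)).
by rewrite pmulr_rgt0//; lra.
Qed.

Lemma profile_homo a b : 0 <= a -> a <= b -> g a <= g b.
Proof.
move=> a0 ab; have [b0|b0] := eqVneq b 0.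
  suff -> : a = b by [].
  by apply/eqP; rewrite eq_le ab b0.
have {}b0 : 0 < b by rewrite lt_def b0 (le_trans a0).
have [->|an0] := eqVneq a 0; first by rewrite g0.
have [->//|anb] := eqVneq a b.
have ab01 : 0 < a / b < 1.
  apply/andP; split; first by rewrite divr_gt0// lt_def an0.
  by rewrite ltr_pdivrMr// mul1r lt_neqAle anb.
have := profile_convex 0 b ab01.
rewrite mulr0 add0r g0 mulr0 add0r divfK ?gt_eqF// => /le_trans; apply.
by rewrite ler_piMl//; have /andP[_ /ltW] := ab01.
Qed.

End Profile.

Section Radial.
Context {R : realType} {n : nat}.
Variables (V : set 'rV[R]_n) (g : R -> R).
Hypotheses (cptV : compact V) (V0 : V° 0) (sV : strictly_convex_set V).
Hypotheses (gL : Legendre1 g) (gge0 : forall t, 0 <= g t) (g0 : g 0 = 0).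
Hypothesis dg0 : derive1 g 0 = 0.
Implicit Types x h v : 'rV[R]_n.

Let phi := radial g V.

Lemma radial_convex : convex_fun phi.
Proof.
move=> x y t t01.
apply: le_trans (profile_convex gL _ _ t01); rewrite /phi /radial.
apply: profile_homo => //; first exact: support_ge0.
exact: support_convex.
Qed.

Lemma radial0 : phi 0 = 0.
Proof. by rewrite -[RHS]g0; congr g; exact: support0. Qed.

Lemma radial_gt0 x : x != 0 -> 0 < phi x.
Proof. by move=> x0; apply: profile_gt0 => //; rewrite gt_eqF// support_gt0. Qed.

Lemma radial_is_derive x h v : x != 0 -> V v -> dotv v x = support V x ->
  is_derive x h phi (dotv (derive1 g (support V x) *: v) h).
Proof.
move=> x0 Vv vx; apply/is_derive_line; rewrite dotvZl.
have /is_derive_line ds := support_is_derive cptV V0 h sV x0 Vv vx.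
apply: (is_derive1_comp (f := g) (g := fun t => support V (x + t *: h))) => //.
rewrite scale0r addr0 derive1E; apply: derivableP.
exact: profile_derivable.
Qed.

(** The support function has a kink at [0], but it grows at most linearly and
    [g] is flat there. *)
Lemma radial_is_derive0 h : is_derive 0 h phi 0.
Proof.
apply/is_derive_line/is_derive0P => e e0.
pose C := support V h + support V (- h) + 1.
have C0 : 0 < C by rewrite ltr_wpDl// addr_ge0// support_ge0.
have sC t : support V (t *: h) <= C * `|t|.
  have := support_ge0 cptV V0 h; have := support_ge0 cptV V0 (- h) => h1 h2.
  case: (leP 0 t) => t0.
    by rewrite supportZ// ger0_norm// mulrC ler_wpM2r// /C; lra.
  have t' : 0 <= - t by rewrite oppr_ge0 ltW.
  rewrite -[t]opprK scaleNr -scalerN supportZ// normrN ger0_norm// mulrC.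
  by rewrite ler_wpM2r// /C; lra.
have : is_derive (0 : R) (1 : R) g 0.
  by rewrite -[X in is_derive _ _ _ X]dg0 derive1E; apply/derivableP/profile_derivable.
move=> /is_derive0P/(_ _ (divr_gt0 e0 C0))/nbhs_ballP[d /= d0 gd].
apply/nbhs_ballP; exists (d / C) => /=; first by rewrite divr_gt0.
move=> t; rewrite /ball/= sub0r normrN ltr_pdivlMr// => td.
rewrite !add0r scale0r radial0 subr0 mulr0 subr0 ger0_norm; last exact: gge0.
have gs s : 0 <= s -> s < d -> g s <= e / C * s.
  move=> s0 sd; have := gd s.
  rewrite /ball/= sub0r normrN g0 mulr0 !subr0 (ger0_norm s0) => /(_ sd).
  by rewrite ger0_norm.
apply: (@le_trans _ _ (g (C * `|t|))).
  by apply: profile_homo => //; [exact: support_ge0 | exact: sC].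
have -> : e * `|t| = e / C * (C * `|t|) by rewrite mulrA divfK ?gt_eqF.
by apply: gs; [rewrite mulr_ge0// ltW | rewrite mulrC].
Qed.

Lemma radial_gateaux : gateaux phi /\ grad phi 0 = 0.
Proof.
have vP x : exists v, V v /\ dotv v x = support V x.
  by have [v [Vv -> _]] := supportP cptV V0 x; exists v.
have [v vx] := choice vP.
pose G x := if x == 0 then 0 else derive1 g (support V x) *: v x.
have [gE gt] : grad phi = G /\ gateaux phi.
  apply: gateaux_intro => x h; rewrite /G; case: eqVneq => [->|x0].
    by rewrite dot0v; exact: radial_is_derive0.
  by have [? ?] := vx x; apply: radial_is_derive.
by split => //; rewrite gE /G eqxx.
Qed.

End Radial.

(** * The robust path and the central path *)

Lemma affine_Aff (R : realType) n (X : set 'rV[R]_n) : affine_set (Aff X).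
Proof.
by move=> x y t Ax Ay A AX; apply: (AX.1); [exact: Ax | exact: Ay].
Qed.

Lemma sub_Aff (R : realType) n (X : set 'rV[R]_n) : X `<=` Aff X.
Proof. by move=> x Xx A [_ /(_ _ Xx)]. Qed.

Section Bound.
Context {R : realType} {n : nat}.
Variables (phi : 'rV[R]_n -> R) (kappa : R).
Hypotheses (gphi : gateaux phi) (cphi : convex_fun phi) (dphi0 : grad phi 0 = 0).
Hypotheses (phi0 : phi 0 = 0) (phigt0 : forall x, x != 0 -> 0 < phi x).
Hypothesis ex : expansive phi kappa.
Implicit Types x y s d : 'rV[R]_n.

Let D0 x y : 0 <= Bregman phi x y.
Proof. exact: Bregman_ge0. Qed.

(** Projections onto singletons do not depend on the projected point, so the
    translation clause of expansiveness compares divergences at unrelated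
    places. *)
Lemma expansive_singleton s x d :
  Bregman phi (s + d) s <= kappa * Bregman phi x (x + d).
Proof.
have cs : closed [set s] by exact/accessible_closed_set1/hausdorff_accessible/norm_hausdorff.
have vs : convex_set [set s].
  apply: convex_set_intro => _ _ t -> -> _.
  by rewrite /= -scalerDl subrK scale1r.
have [_] := ex (ex_intro _ s erefl) cs vs x (x + d).
apply.
  split; first by exists s => //; rewrite (addrC x) addrK.
  by move=> _ [_ -> <-]; rewrite (addrC x) addrK.
by split => // _ ->.
Qed.

Lemma Bregman0r x : Bregman phi x 0 = phi x.
Proof. by rewrite /Bregman dphi0 dot0v phi0 !subr0. Qed.

Lemma expansive_ge1 : (0 < n)%N -> 1 <= kappa.
Proof.
move=> n0; pose d : 'rV[R]_n := const_mx 1.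
have d0 : d != 0.
  by apply/eqP => /rowP/(_ (Ordinal n0)); rewrite !mxE => /eqP; rewrite oner_eq0.
have s0 : 0 < slope phi 0 d.
  by rewrite slopeE add0r Bregman0r ltr_wpDr// phigt0.
have := slope_le expansive_singleton 0 0 d.
by rewrite -{1}[slope _ _ _]mul1r ler_pM2r.
Qed.

(** The form [dotv c x + w * phi x + m] covers both paths and the projections,
    since a Bregman divergence is affine in its first argument up to [phi]. *)
Lemma argmin_variational X c (w m : R) F p : convex_set X -> 0 < w ->
  (forall x, F x = dotv c x + w * phi x + m) -> argmin X F p ->
  forall y, X y -> 0 <= dotv (c + w *: grad phi p) (y - p).
Proof.
move=> cX w0 FE [Xp pmin] y Xy.
have : - (dotv c (y - p) / w) <= dotv (grad phi p) (y - p).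
  apply: gateaux_ge => // t /andP[t0 t1].
  have := pmin (p + t *: (y - p)); rewrite !FE.
  have -> : p + t *: (y - p) = (1 - t) *: p + t *: y.
    by rewrite scalerBr scalerBl scale1r addrCA addrC.
  have t01 : 0 <= t <= 1 by rewrite !ltW.
  move=> /(_ (convex_setP cX Xp Xy t01)) H.
  have {}H : w * (phi p + t * - (dotv c (y - p) / w)) <=
      w * phi ((1 - t) *: p + t *: y).
    have -> : w * (phi p + t * - (dotv c (y - p) / w)) =
        w * phi p - t * dotv c (y - p) by field; rewrite gt_eqF.
    by move: H; rewrite !dotvE; lra.
  by rewrite ler_pM2l in H.
rewrite -mulNr ler_pdivrMr// (dotvDl c) dotvZl; lra.
Qed.

Section Constrained.
Variable X : set 'rV[R]_n.
Hypothesis cX : convex_set X.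
Hypothesis n_gt0 : (0 < n)%N.

Let k1 : 1 <= kappa.
Proof. exact: expansive_ge1. Qed.

Lemma proj0_argmin S : Bregman_proj phi S 0 = argmin S phi.
Proof.
by rewrite /Bregman_proj; congr argmin; apply/funext => x; exact: Bregman0r.
Qed.

(** Two minimisers have divergence [0], and [expansive_singleton] transports this
    to [D(q - p, 0) = phi (q - p)]. *)
Lemma argmin_unique p q : argmin X phi p -> argmin X phi q -> p = q.
Proof.
move=> mp mq; apply/eqP; rewrite -subr_eq0; apply/negPn/negP => pq0.
have [Xp pmin] := mp; have [Xq qmin] := mq.
have FE x : phi x = dotv 0 x + 1 * phi x + 0 by rewrite dot0v; ring.
have := argmin_variational cX ltr01 FE mq Xp.
rewrite add0r scale1r => v.
have D : Bregman phi p q <= 0.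
  by have := pmin _ Xq; rewrite /Bregman; lra.
have := expansive_singleton 0 p (q - p).
rewrite (addrC p) subrK add0r Bregman0r.
apply/negP; rewrite -ltNge; apply: (@le_lt_trans _ _ 0).
  by rewrite pmulr_rle0// (lt_le_trans ltr01).
by apply: phigt0; rewrite -opprB oppr_eq0.
Qed.

Lemma proj_Aff_orthogonal q x y : argmin (Aff X) phi q -> X x -> X y ->
  dotv (grad phi q) (x - y) = 0.
Proof.
move=> mq; have [Aq _] := mq.
have cA : convex_set (Aff X).
  by apply: convex_set_intro => u v t Au Av _; exact: affine_Aff.
have FE u : phi u = dotv 0 u + 1 * phi u + 0 by rewrite dot0v; ring.
have ge0 u : Aff X u -> 0 <= dotv (grad phi q) (u - q).
  by move=> /(argmin_variational cA ltr01 FE mq); rewrite add0r scale1r.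
have orth u : X u -> dotv (grad phi q) (u - q) = 0.
  move=> /sub_Aff Au; apply/eqP; rewrite eq_le (ge0 _ Au) andbT.
  (* the reflection of [u] through [q] *)
  have := ge0 _ (affine_Aff (- 1) Aq Au).
  have -> : (1 - - 1) *: q + - 1 *: u - q = - (u - q).
    by rewrite opprK scalerDl !scale1r scaleN1r opprB addrAC addrK.
  by rewrite dotvNr oppr_ge0.
move=> Xx Xy; have -> : x - y = (x - q) - (y - q) by rewrite opprB addrA subrK.
by rewrite dotvDr dotvNr !orth// subr0.
Qed.

(** Orthogonality of [grad phi pA] to [x - r] is what lets it enter the sum of the
    two optimality conditions, and [Bregman_transport] then applies. *)
Lemma robust_central_bound a w xR pX pA r x : 0 < w ->
  argmin X phi xR -> Bregman_proj phi X 0 pX -> Bregman_proj phi (Aff X) 0 pA ->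
  robust_path X a phi w r -> central_path X a phi xR w x ->
  Bregman phi x r <= kappa ^+ 2 * Bregman phi pX pA /\
  Bregman phi r x <= kappa ^+ 2 * Bregman phi pA pX.
Proof.
rewrite !proj0_argmin => w0 mR mX mA mr mx.
have eR := argmin_unique mR mX; subst xR.
have [[Xr _] [Xx _]] := (mr, mx).
have Er u : dotv a u + w * phi u = dotv a u + w * phi u + 0 by rewrite addr0.
have Ex u : dotv a u + w * Bregman phi u pX = dotv (a - w *: grad phi pX) u
    + w * phi u + w * (dotv (grad phi pX) pX - phi pX).
  by rewrite /Bregman !dotvE; ring.
have vr := argmin_variational cX w0 Er mr Xx.
have vx := argmin_variational cX w0 Ex mx Xr.
have ortho := proj_Aff_orthogonal mA Xx Xr.
have k0 : 0 < kappa by rewrite (lt_le_trans ltr01).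
have key : Bregman phi x r + Bregman phi r x <=
    dotv (grad phi pX - grad phi pA) (x - r).
  rewrite -(ler_pM2l w0); move: vr vx ortho.
  by rewrite /Bregman !dotvE; nra.
have [b1 b2] :=
  Bregman_transport gphi D0 k0 expansive_singleton k1 key.
have kk y z : kappa * Bregman phi y z <= kappa ^+ 2 * Bregman phi y z.
  by rewrite ler_wpM2r// expr2 ler_pMr.
by split; [exact: le_trans (kk _ _) | exact: le_trans (kk _ _)].
Qed.

End Constrained.

End Bound.

(** * The Euclidean ball and sharpness *)

Section Ball.
Context {R : realType} {n : nat}.
Implicit Types x y u v h : 'rV[R]_n.

Definition unit_ball : set 'rV[R]_n := [set x | dotv x x <= 1].

Local Notation V := unit_ball.

Lemma closed_ball : closed V.
Proof.
have := @preimage_closed _ _ _ [set y : R | y <= 1]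
  (fun w _ => @sqnorm_continuous R n w) (@closed_le _ 1).
exact.
Qed.

Lemma compact_ball : compact V.
Proof.
apply: (subclosed_compact closed_ball
  (rV_compact (fun i : 'I_n => @segment_compact R (- 1) 1))).
move=> x xV i /=; rewrite in_itv/= -ler_norml.
rewrite -(@ler_pXn2r _ 2)// ?nnegrE// expr1n real_normK ?num_real//.
apply: le_trans xV; rewrite /dotv (bigD1 i)//= -expr2 lerDl.
by apply: sumr_ge0 => j _; rewrite -expr2 sqr_ge0.
Qed.

Lemma interior_ball x : dotv x x < 1 -> V° x.
Proof.
move=> x1; have H := cvgr_lt _ (@sqnorm_continuous R n x) _ x1.
by apply: filterS (H (nbhs_filter x)) => y /ltW.
Qed.

Lemma frontier_ball x : frontier V x -> dotv x x = 1.
Proof.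
move=> [/closed_ball xV xi]; apply/eqP; rewrite eq_le xV /= leNgt.
by apply/negP => /interior_ball.
Qed.

Lemma ball_combination x y (t : R) :
  dotv ((1 - t) *: x + t *: y) ((1 - t) *: x + t *: y) =
  (1 - t) * dotv x x + t * dotv y y - t * (1 - t) * dotv (x - y) (x - y).
Proof. by rewrite !dotvE (dotvC y x); ring. Qed.

Lemma convex_ball : convex_set V.
Proof.
apply: convex_set_intro => x y t xV yV /andP[t0 t1].
rewrite /unit_ball/= ball_combination.
have t1' : 0 <= 1 - t by rewrite subr_ge0.
have h1 := mulr_ge0 (mulr_ge0 t0 t1') (dotv_ge0 (x - y)).
have h2 := ler_wpM2l t1' xV; have h3 := ler_wpM2l t0 yV.
by lra.
Qed.

Lemma ball0 : V° 0.
Proof. by apply: interior_ball; rewrite dot0v. Qed.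

Lemma strictly_convex_ball : strictly_convex_set V.
Proof.
split; [exact: convex_ball | by exists 0; exact: ball0 |].
move=> x y /frontier_ball x1 /frontier_ball y1 xy t /andP[t0 t1].
apply: interior_ball; rewrite ball_combination x1 y1.
have d0 : 0 < dotv (x - y) (x - y) by rewrite dotv_gt0// subr_eq0.
have : 0 < t * (1 - t) * dotv (x - y) (x - y).
  by rewrite !mulr_gt0// subr_gt0.
by lra.
Qed.

(** The Euclidean length [r] of [x], kept abstract as a positive root of
    [dotv x x]. *)
Lemma norm_attained x : x != 0 -> exists r : R,
  [/\ 0 < r, r ^+ 2 = dotv x x & V (r^-1 *: x)].
Proof.
move=> x0; exists (Num.sqrt (dotv x x)).
have r0 : 0 < Num.sqrt (dotv x x) by rewrite sqrtr_gt0 dotv_gt0.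
split => //; first by rewrite sqr_sqrtr// dotv_ge0.
rewrite /unit_ball/= dotvZl dotvZr mulrA -expr2 exprVn sqr_sqrtr ?dotv_ge0//.
by rewrite mulVf// gt_eqF// dotv_gt0.
Qed.

(** A normal [u] at [x] satisfies [|u| <= <u, x>], the case of equality in
    Cauchy-Schwarz, so it is a multiple of [x]. *)
Lemma smooth_ball : smooth_set V.
Proof.
split; [exact: convex_ball | by exists 0; exact: ball0 |].
move=> x /frontier_ball x1; exists [set y | dotv x y = dotv x x]; split.
  exists x; split => //.
    by rewrite -dotv_eq0 x1 oner_eq0.
  move=> y; rewrite /unit_ball/= => yV; have := dotv_ge0 (x - y).
  by rewrite !dotvE (dotvC y x); lra.
move=> H [u [u0 -> umax]].
have [r [r0 r2 /umax]] := norm_attained u0.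
rewrite dotvZr -r2 expr2 mulrA mulVf ?gt_eqF// mul1r => ru.
have urx : u = r *: x.
  apply/eqP; rewrite -subr_eq0 -dotv_eq0 eq_le dotv_ge0 andbT.
  by rewrite !dotvE (dotvC x u) x1 -r2; nra.
apply/seteqP; split => y /=; rewrite urx !dotvZl; first by move=> ->.
by apply: mulfI; rewrite gt_eqF.
Qed.

Definition square (t : R) : R := t ^+ 2.

Lemma radial_square x : radial square V x = dotv x x.
Proof.
have [v [vV sE vmax]] := supportP compact_ball ball0 x.
have [->|x0] := eqVneq x 0.
  by rewrite (radial0 compact_ball ball0) ?dot0v// /square expr0n.
have [r [r0 r2 /vmax]] := norm_attained x0.
rewrite dotvZl -r2 expr2 mulrA mulVf ?gt_eqF// mul1r => rs.
suff sr : support V x = r by rewrite /radial -/(support V x) sr.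
apply/eqP; rewrite eq_le rs andbT sE -(ler_pM2l r0).
have := dotv_ge0 (r *: v - x); rewrite !dotvE (dotvC x v) -r2.
by move: vV; rewrite /unit_ball/=; nra.
Qed.

Local Notation phi := (radial square V).

Lemma grad_square : grad phi = (fun x => 2 *: x) /\ gateaux phi.
Proof.
have -> : phi = (fun x => dotv x x) by apply/funext => x; exact: radial_square.
apply: gateaux_intro => x h; apply/is_derive_line/is_derive0P => e e0.
have c0 : 0 < dotv h h + 1 by rewrite ltr_wpDl// dotv_ge0.
apply/nbhs_ballP; exists (e / (dotv h h + 1)) => /=; first by rewrite divr_gt0.
move=> t; rewrite /ball/= sub0r normrN ltr_pdivlMr// => td.
have -> : dotv (x + t *: h) (x + t *: h) - dotv (x + 0 *: h) (x + 0 *: h) -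
    t * dotv (2 *: x) h = t * (t * dotv h h).
  by rewrite !dotvE (dotvC h x); ring.
rewrite normrM mulrC ler_wpM2r// normrM (ger0_norm (dotv_ge0 h)).
by apply: le_trans (ltW td); rewrite ler_wpM2l// lerDl.
Qed.

Lemma Bregman_square x y : Bregman phi x y = dotv (x - y) (x - y).
Proof.
by rewrite /Bregman grad_square.1 !radial_square !dotvE (dotvC y x); ring.
Qed.

Lemma proj_square (S : set 'rV[R]_n) x p s : convex_set S ->
  Bregman_proj phi S x p -> S s -> 0 <= dotv (p - x) (s - p).
Proof.
move=> cS pS Ss.
have FE u : Bregman phi u x = dotv (- 2 *: x) u + 1 * phi u + dotv x x.
  by rewrite Bregman_square radial_square !dotvE (dotvC u x); ring.
have := argmin_variational grad_square.2 cS ltr01 FE pS Ss.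
rewrite grad_square.1 scale1r -[_ + _ *: _]/(_ + _) scaleNr addrC -scalerBr.
by rewrite dotvZl pmulr_rge0.
Qed.

(** Both clauses reduce to [|p - q|^2 <= <p - q, v>], with [v] the displacement of
    the projected point or of the set; it is the sum of the two variational
    inequalities. *)
Lemma expansive_square : expansive phi 1.
Proof.
move=> S S0 clS cS x y.
have young u v : 0 <= dotv u (v - u) -> dotv u u <= 1 * dotv v v.
  have := dotv_ge0 (v - u); rewrite !dotvE (dotvC v u); lra.
split=> p q pS qS; rewrite !Bregman_square.
  have [[Sp _] [Sq _]] := (pS, qS).
  have := proj_square cS pS Sq; have := proj_square cS qS Sp => h1 h2.
  apply: young; move: h1 h2.
  by rewrite !dotvE (dotvC q p) (dotvC x p) (dotvC x q) (dotvC y p) (dotvC y q); lra.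
have cS' : convex_set [set s + (y - x) | s in S].
  apply: convex_set_intro => _ _ t [s Ss <-] [s' Ss' <-] t01.
  exists ((1 - t) *: s + t *: s'); first exact: convex_setP.
  by move: (y - x) => d; rewrite !scalerDr addrACA -scalerDl subrK scale1r.
have [[[s Ss sp] _] [Sq _]] := (pS, qS).
have h1 : 0 <= dotv (q - x) (p - (y - x) - q).
  by rewrite -sp addrK; exact: proj_square cS qS Ss.
have h2 : 0 <= dotv (p - x) (q + (y - x) - p).
  by apply: proj_square pS _ => //; exists q.
rewrite -(opprB y x) dotvNl dotvNr opprK.
apply: young; move: h1 h2; rewrite !dotvE.
rewrite (dotvC q p) (dotvC x p) (dotvC x q); lra.
Qed.

End Ball.

Lemma Legendre1_square (R : realType) : Legendre1 (@square R).
Proof.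
split; split.
- by split=> [x|]; [rewrite ltNyr | exists 0; rewrite /dom/= ltry].
- move=> x a; rewrite lte_fin => ax.
  pose f (y : 'rV[R]_1) := dotv y y.
  have fE y : f y = square (y 0 0) by rewrite /f /dotv big_ord1 -expr2.
  rewrite -fE in ax.
  have H := cvgr_gt _ (@sqnorm_continuous R 1 x) _ ax.
  exists [set y | a < f y]; first exact: (H (nbhs_filter x)).
  by move=> y; rewrite lte_fin -fE.
- move=> x y t /andP[t0 t1]; rewrite -!EFinM -EFinD lee_fin !mxE /square.
  have : 0 <= t * (1 - t) * (x 0 0 - y 0 0) ^+ 2.
    by rewrite mulr_ge0 ?sqr_ge0// mulr_ge0 ?subr_ge0// ltW.
  by rewrite !expr2; nra.
- by rewrite dom_profile; exists 0.
- move=> x _.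
  have -> : fine \o (fun x : 'rV[R]_1 => (square (x 0 0))%:E) =
     (fun x : 'rV[R]_1 => x 0 0 : R) ^+ 2 by [].
  apply: differentiableX; exact: differentiable_coord.
- move=> x y t _ _ xy /andP[t0 t1].
  rewrite -!EFinM -EFinD lte_fin !mxE /square.
  have xy0 : x 0 0 - y 0 0 != 0.
    rewrite subr_eq0; apply: contra xy => /eqP xy.
    by apply/eqP/rowP => i; rewrite (ord1 i).
  have : 0 < t * (1 - t) * (x 0 0 - y 0 0) ^+ 2.
    by rewrite mulr_gt0 ?exprn_even_gt0// mulr_gt0 ?subr_gt0.
  by rewrite !expr2; nra.
- by move=> u x _ [_]; rewrite dom_profile => -[].
Qed.

Section Sharp.
Context {R : realType} {n : nat}.
Variable i : 'I_n.
Local Notation phi := (radial (@square R) (@unit_ball R n)).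

Let e : 'rV[R]_n := delta_mx 0 i.
Definition halfspace : set 'rV[R]_n := [set x | 1 <= x 0 i].

Let ee : dotv e e = 1.
Proof. by rewrite dotv_delta mxE !eqxx. Qed.

Let eX x : dotv x e = x 0 i.
Proof. exact: dotv_delta. Qed.

Lemma halfspace_e (t : R) : 1 <= t -> halfspace (t *: e).
Proof. by rewrite /halfspace/= -eX dotvZl ee mulr1. Qed.

Lemma closed_halfspace : closed halfspace.
Proof.
have := @preimage_closed _ _ _ [set y : R | 1 <= y]
  (fun w _ => @coord_continuous R 1 n 0 i w) (@closed_ge _ 1).
exact.
Qed.

Lemma convex_halfspace : convex_set halfspace.
Proof.
apply: convex_set_intro => x y t; rewrite /halfspace/= !mxE => x1 y1 /andP[t0 t1].
by nra.
Qed.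

(** Extrapolating from [2 *: e] through [e] reaches [0]. *)
Lemma Aff_halfspace0 : Aff halfspace 0.
Proof.
have h2 : Aff halfspace (2 *: e).
  by apply: sub_Aff; apply: halfspace_e; lra.
have h1 : Aff halfspace (1 *: e).
  by apply: sub_Aff; apply: halfspace_e.
have := affine_Aff 2 h2 h1.
by rewrite !scalerA -scalerDl [_ + _](_ : _ = 0) ?scale0r//; ring.
Qed.

(** With [a0 = - 2 *: e] and weight [1] both objectives are, up to a constant,
    squared distances: to [e] for the robust path, to [2 *: e] for the central
    path started at [e].  Both points lie in the half-space. *)
Lemma sharp_halfspace : exists xR pX pA xrob xCP : 'rV[R]_n,
  [/\ argmin halfspace phi xR, Bregman_proj phi halfspace 0 pX &
      Bregman_proj phi (Aff halfspace) 0 pA] /\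
  [/\ robust_path halfspace (- 2 *: e) phi 1 xrob &
      central_path halfspace (- 2 *: e) phi xR 1 xCP] /\
  [/\ Bregman phi xCP xrob = 1, Bregman phi pX pA = 1,
      Bregman phi xrob xCP = 1 & Bregman phi pA pX = 1].
Proof.
have Xe : halfspace e by rewrite -[e]scale1r; exact: halfspace_e.
exists e, e, 0, e, (2 *: e); split; last split.
- split; split => //.
  + move=> x; rewrite /halfspace/= -eX !radial_square ee => x1.
    have := dotv_ge0 (x - e); rewrite !dotvE ee (dotvC e x); lra.
  + move=> x; rewrite /halfspace/= -eX !Bregman_square !subr0 ee => x1.
    have := dotv_ge0 (x - e); rewrite !dotvE ee (dotvC e x); lra.
  + exact: Aff_halfspace0.
  + by move=> x _; rewrite !Bregman_square subr0 dot0v dotv_ge0.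
- split; split => //.
  + move=> x _; rewrite !radial_square.
    have := dotv_ge0 (x - e); rewrite !dotvE ee (dotvC e x); lra.
  + by apply: halfspace_e; lra.
  + move=> x _; rewrite !Bregman_square.
    have := dotv_ge0 (x - 2 *: e); rewrite !dotvE ee (dotvC e x); lra.
- rewrite !Bregman_square; split; rewrite !dotvE ?dot0v ?dotv0 ?ee; lra.
Qed.

End Sharp.

Theorem theorem2 (R : realType) (n : nat) (n_gt0 : (0 < n)%N) :
  (forall (X : set 'rV[R]_n) (a0 : 'rV[R]_n) (V : set 'rV[R]_n)
          (g : R -> R) (kappa : R),
     X !=set0 -> closed X -> convex_set X ->
     compact V -> smooth_set V -> strictly_convex_set V -> V° 0 ->
     (forall t, 0 <= g t) -> Legendre1 g -> g 0 = 0 -> derive1 g 0 = 0 ->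
     let phi := radial g V in
     expansive phi kappa ->
     forall xR pX pA : 'rV[R]_n,
     argmin X phi xR ->
     Bregman_proj phi X 0 pX ->
     Bregman_proj phi (Aff X) 0 pA ->
     forall omega : R, 0 < omega ->
     forall xrob xCP : 'rV[R]_n,
     robust_path X a0 phi omega xrob ->
     central_path X a0 phi xR omega xCP ->
     Bregman phi xCP xrob <= kappa ^+ 2 * Bregman phi pX pA /\
     Bregman phi xrob xCP <= kappa ^+ 2 * Bregman phi pA pX)
  /\
  (exists (X : set 'rV[R]_n) (a0 : 'rV[R]_n) (V : set 'rV[R]_n)
          (g : R -> R) (kappa : R),
     let phi := radial g V in
     [/\ X !=set0, closed X & convex_set X] /\
     [/\ compact V, smooth_set V, strictly_convex_set V & V° 0] /\
     [/\ (forall t, 0 <= g t), Legendre1 g, g 0 = 0 & derive1 g 0 = 0] /\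
     expansive phi kappa /\
     exists (xR pX pA : 'rV[R]_n) (omega : R) (xrob xCP : 'rV[R]_n),
     [/\ argmin X phi xR, Bregman_proj phi X 0 pX &
         Bregman_proj phi (Aff X) 0 pA] /\
     [/\ 0 < omega, robust_path X a0 phi omega xrob &
         central_path X a0 phi xR omega xCP] /\
     [/\ Bregman phi xCP xrob = kappa ^+ 2 * Bregman phi pX pA,
         Bregman phi xCP xrob != 0,
         Bregman phi xrob xCP = kappa ^+ 2 * Bregman phi pA pX &
         Bregman phi xrob xCP != 0]).
Proof.
split.
- move=> X a0 V g kappa _ _ cX cptV _ sV V0 gge0 gL g0 dg0 phi ex.
  move=> xR pX pA mR mX mA w w0 r x mr mx.
  have [gphi dphi0] := radial_gateaux cptV V0 sV gL gge0 g0 dg0.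
  apply: (robust_central_bound gphi _ dphi0 _ _ ex cX n_gt0 w0 mR mX mA mr mx).
  + exact: radial_convex.
  + exact: radial0.
  + by move=> y; apply: radial_gt0.
- have [xR [pX [pA [xrob [xCP [h1 [[h2 h3] [e1 e2 e3 e4]]]]]]]] :=
    @sharp_halfspace R n (Ordinal n_gt0).
  exists (halfspace (Ordinal n_gt0)), (- 2 *: delta_mx 0 (Ordinal n_gt0)).
  exists unit_ball, (@square R), 1.
  split.
    split; [|exact: closed_halfspace|exact: convex_halfspace].
    by have [[Xx _] _ _] := h1; exists xR.
  split.
    split; [exact: compact_ball | exact: smooth_ball |
            exact: strictly_convex_ball | exact: ball0].
  split.
    split; [by move=> t; exact: sqr_ge0 | exact: Legendre1_square |
            by rewrite /square expr0n |].
    by rewrite derive1E exp_derive expr1 scaler0 scale0r.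
  split; first exact: expansive_square.
  exists xR, pX, pA, 1, xrob, xCP; split => //; split => //.
  by rewrite e1 e2 e3 e4 expr1n mulr1; split => //; exact: oner_neq0.
Qed.
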